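(* Suppose $f,f_1,\dots,f_J$ satisfy the $\lambda$-smooth assumption (no convexity is assumed), and let $(\theta_k)_{k\ge0}$ be the SGD iterates with constant step-size $0<\eta<\frac{1}{2\lambda_{\max,0}}$. Define $$z_0=\frac{-2\eta\Lambda D_0+\sqrt{4\eta^2\Lambda^2D_0^2+8\eta\lambda_{\max,0}D_0^2}}{4\lambda_{\max,0}} .$$ Then: (1) $\displaystyle\limsup_{k\to\infty}R_k\ge z_0^2$. (2) If $\eta$ is small enough that $$\frac{\eta^2\Lambda D_0}{1-2\eta\lambda_{\max,0}}\le z_0,$$ then $\displaystyle\liminf_{k\to\infty}R_k\ge z_0^2$.
   Context: Let $d,J\ge 1$, let $f_1,\dots,f_J:\mathbb{R}^d\to\mathbb{R}$ be differentiable, and let $f=\frac1J\sum_{j=1}^J f_j$. Let $\theta^\dagger\in\mathbb{R}^d$ be an optimal solution (global minimizer) of $\min_{\theta\in\mathbb{R}^d} f(\theta)$, assumed to exist; in particular $\nabla f(\theta^\dagger)=0$. $|\cdot|$ denotes the Euclidean norm. $\lambda$-smooth assumption: there are constants $\lambda_{\max,0},\lambda_{\max,1},\dots,\lambda_{\max,J}>0$ such that for all $\theta_1,\theta_2\in\mathbb{R}^d$: $|\nabla f(\theta_1)-\nabla f(\theta_2)|\le\lambda_{\max,0}|\theta_1-\theta_2|$ and $|\nabla f_j(\theta_1)-\nabla f_j(\theta_2)|\le\lambda_{\max,j}|\theta_1-\theta_2|$ for every $j=1,\dots,J$. Notation: $D_0=\left(\frac1J\sum_{j=1}^J|\nabla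 f_j(\theta^\dagger)|^2\right)^{1/2}$ and $\Lambda=\left(\frac1J\sum_{j=1}^J\lambda_{\max,j}^2\right)^{1/2}$. SGD with constant step-size $\eta>0$: $\theta_{k+1}=\theta_k-\eta\nabla f_{\gamma_k}(\theta_k)$ for $k\ge 0$, where $\gamma_0,\gamma_1,\dots$ are i.i.d. uniform on $\{1,\dots,J\}$ and the initial point $\theta_0$ (possibly random) is independent of $(\gamma_k)_{k\ge0}$ with $\mathbb{E}|\theta_0-\theta^\dagger|^2<\infty$. The error is $R_k=\mathbb{E}|\theta_k-\theta^\dagger|^2$. The $\limsup$ and $\liminf$ are taken in $[0,\infty]$. *)

(* Defs.v *)
From HB Require Import structures.
From mathcomp Require Import all_boot all_order all_algebra finmap.
From mathcomp Require Import all_classical all_reals all_analysis.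

Set Implicit Arguments.
Unset Strict Implicit.
Unset Printing Implicit Defensive.

Import Order.TTheory GRing.Theory Num.Theory.
Import numFieldNormedType.Exports.

Local Open Scope classical_set_scope.
Local Open Scope ring_scope.

(* The library's norm on 'rV[R]_d is the sup norm, hence the separate
   Euclidean norm; both induce the library's topology on 'rV[R]_d. *)
Definition enorm {R : realType} {d : nat} (x : 'rV[R]_d) : R :=
  Num.sqrt (\sum_(i < d) x 0 i ^+ 2).

Definition grad {R : realType} {d : nat} (f : 'rV[R]_d -> R) (x : 'rV[R]_d) :
    'rV[R]_d :=
  \row_(i < d) 'D_(delta_mx 0 i) f x.

Definition grad_lipschitz {R : realType} {d : nat} (f : 'rV[R]_d -> R)
    (L : R) : Prop :=
  forall x y : 'rV[R]_d, enorm (grad f x - grad f y) <= L * enorm (x - y).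

Definition average {R : realType} {d J : nat} (f : 'I_J -> 'rV[R]_d -> R)
    (x : 'rV[R]_d) : R :=
  J%:R^-1 * \sum_(j < J) f j x.

Definition rms {R : realType} {J : nat} (a : 'I_J -> R) : R :=
  Num.sqrt (J%:R^-1 * \sum_(j < J) a j ^+ 2).

Definition borel {R : realType} {d : nat} : set (set 'rV[R]_d) :=
  <<s [set A : set 'rV[R]_d | open A] >>.

(* Sigma-algebra generated by X, for a codomain with sigma-algebra G; X is
   measurable iff it is contained in [measurable].  The codomains used here are
   ('rV[R]_d, borel) and 'I_J with all its subsets. *)
Definition sigma_gen {T U : Type} (X : T -> U) (G : set (set U)) :
    set (set T) :=
  preimage_set_system [set: T] X G.

Definition sigma_gen_seq {T U : Type} (X : nat -> T -> U) (G : set (set U)) :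
    set (set T) :=
  <<s \bigcup_k sigma_gen (X k) G >>.

Section independence.
Context {disp : measure_display} {T : measurableType disp} {R : realType}.
Variable P : probability T R.
Local Open Scope ereal_scope.

Definition independent (E F : set (set T)) : Prop :=
  forall A B, E A -> F B -> P (A `&` B) = P A * P B.

Definition mutually_independent {I : choiceType} (E : I -> set (set T)) :
    Prop :=
  forall (S : {fset I}) (A : I -> set T), (forall i, i \in S -> E i (A i)) ->
    P (\bigcap_(i in [set` S]) A i) = \prod_(i <- S) P (A i).

Definition iid_uniform {J : nat} (gamma : nat -> T -> 'I_J) : Prop :=
  [/\ forall k, sigma_gen (gamma k) discrete_measurable `<=` measurable,
      mutually_independent (fun k => sigma_gen (gamma k) discrete_measurable)
    & forall k j, P (gamma k @^-1` [set j]) = (J%:R^-1)%:E].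

End independence.

Definition sgd {T : Type} {R : realType} {d J : nat}
    (f : 'I_J -> 'rV[R]_d -> R) (eta : R) (gamma : nat -> T -> 'I_J)
    (theta : nat -> T -> 'rV[R]_d) : Prop :=
  forall k w, theta k.+1 w = theta k w - eta *: grad (f (gamma k w)) (theta k w).

Definition mean_sq_error {disp : measure_display} {T : measurableType disp}
    {R : realType} (P : probability T R) {d : nat} (theta_min : 'rV[R]_d)
    (theta : nat -> T -> 'rV[R]_d) (k : nat) : \bar R :=
  ('E_P[fun w => (enorm (theta k w - theta_min) ^+ 2)%R])%E.

Definition error_floor {R : realType} (eta lambda0 Lambda D0 : R) : R :=
  (- (2 * eta * Lambda * D0)
   + Num.sqrt (4 * eta ^+ 2 * Lambda ^+ 2 * D0 ^+ 2
               + 8 * eta * lambda0 * D0 ^+ 2)) / (4 * lambda0).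

(* Main.v *)
Require Import Defs.
From mathcomp Require Import all_boot all_order all_algebra finmap.
From mathcomp Require Import all_classical all_reals all_analysis.
From mathcomp Require Import measurable_realfun ring lra.
Import Order.TTheory GRing.Theory Num.Theory.
Import numFieldNormedType.Exports.
Local Open Scope classical_set_scope.
Local Open Scope ring_scope.

(** Why the theorem is true.  Write m for the minimizer, r = |theta_k - m|, and
    average one step over the index gamma_k, which is uniform and independent
    of theta_k.  Expanding the square, the drift costs at most
    2 eta lambda0 r^2, because the gradient of the average vanishes at m, while
    the gradient noise keeps the squared gradients at about their size D0^2 at
    m, up to a Cauchy-Schwarz error 2 Lambda D0 r.  So the mean square error
    after the step is at least
      q(r) = (1 - 2 eta lambda0) r^2 - 2 eta^2 Lambda D0 r + eta^2 D0^2
    ([mean_sqr_sgd_step_ge]), and z0 is the nonnegative solution of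
    q(z) = z^2 ([error_floor_root]).

    The term that is linear in r would call for Jensen's inequality and lead to
    a recursion in the square root of R_k.  The inequality
    2 r <= r^2 / z0 + z0, an equality at r = z0, makes everything affine in r^2
    instead ([error_rate_tangent]): with
      a = 1 - 2 eta lambda0 - eta^2 Lambda D0 / z0 < 1
    integration gives the affine recursion
      R_{k+1} >= a R_k + (1 - a) z0^2.
    If R_k stayed below some M < z0^2 from some time on, it would grow by at
    least (1 - a) (z0^2 - M) > 0 at each step, which is absurd; this is part
    (1), [affine_recursion_limn_esup].  The condition of part (2) says exactly that
    a >= 0; then z0^2 - R_k <= a^k (z0^2 - R_0), which tends to 0
    ([affine_recursion_limn_einf]).  When D0 = 0 the floor z0 is 0.

    The probabilistic ingredient is that theta_k is independent of gamma_k.  It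
    is proved for nonnegative continuous observables only, by induction on k,
    in the stronger form that theta_k is independent of all cylinder events on
    gamma_k, gamma_{k+1}, ... ([future_independent_sgd]): conditioning on the
    value of gamma_k turns a cylinder at time k + 1 into a longer one at
    time k. *)

(** * Euclidean geometry and gradients *)

Lemma sum_CauchySchwarz (R : rcfType) (n : nat) (a b : 'I_n -> R) :
  \sum_i a i * b i <=
    Num.sqrt (\sum_i a i ^+ 2) * Num.sqrt (\sum_i b i ^+ 2).
Proof.
set A := \sum_i a i ^+ 2; set B := \sum_i b i ^+ 2; set C := \sum_i _.
have A0 : 0 <= A by apply: sumr_ge0 => i _; exact: sqr_ge0.
have B0 : 0 <= B by apply: sumr_ge0 => i _; exact: sqr_ge0.
have [BE|Bneq0] := eqVneq B 0.
  have b0 i : b i = 0.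
    apply/eqP; rewrite -sqrf_eq0.
    move/eqP: BE; rewrite psumr_eq0; last by move=> k _; exact: sqr_ge0.
    by move/allP/(_ i); rewrite mem_index_enum => /(_ isT).
  rewrite /C big1 ?mulr_ge0 ?sqrtr_ge0// => i _.
  by rewrite b0 mulr0.
rewrite -sqrtrM//; apply: (le_trans (ler_norm C)); rewrite -sqrtr_sqr.
rewrite ler_sqrt ?mulr_ge0//.
have Bgt0 : 0 < B by rewrite lt_def Bneq0.
(* The sum of the squares of B a_i - C b_i equals B (A B - C^2). *)
rewrite -subr_ge0 -(pmulr_rge0 _ Bgt0).
suff -> : B * (A * B - C ^+ 2) = \sum_i (B * a i - C * b i) ^+ 2.
  by apply: sumr_ge0 => i _; exact: sqr_ge0.
have -> : \sum_i (B * a i - C * b i) ^+ 2 = \sum_i B ^+ 2 * a i ^+ 2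
    - \sum_i 2 * B * C * (a i * b i) + \sum_i C ^+ 2 * b i ^+ 2.
  by rewrite -sumrB -big_split/=; apply: eq_bigr => i _; ring.
by rewrite -!mulr_sumr -/A -/B -/C; ring.
Qed.

Definition dot {R : realType} {d : nat} (u v : 'rV[R]_d) : R :=
  \sum_(i < d) u 0 i * v 0 i.

Section euclidean.
Context {R : realType} {d : nat}.
Implicit Types u v : 'rV[R]_d.

Lemma enorm_ge0 u : 0 <= enorm u.
Proof. exact: sqrtr_ge0. Qed.

Lemma enorm_sqr u : enorm u ^+ 2 = dot u u.
Proof.
rewrite sqr_sqrtr; last by apply: sumr_ge0 => i _; exact: sqr_ge0.
by apply: eq_bigr => i _; rewrite expr2.
Qed.

Lemma dot_le_enorm u v : dot u v <= enorm u * enorm v.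
Proof. exact: sum_CauchySchwarz. Qed.

Lemma dotNr u v : dot u (- v) = - dot u v.
Proof. by rewrite /dot -sumrN; apply: eq_bigr => i _; rewrite !mxE mulrN. Qed.

Lemma enormN u : enorm (- u) = enorm u.
Proof. by congr Num.sqrt; apply: eq_bigr => i _; rewrite mxE sqrrN. Qed.

Lemma enorm_sqrD u v :
  enorm (u + v) ^+ 2 = enorm u ^+ 2 + 2 * dot u v + enorm v ^+ 2.
Proof.
rewrite !enorm_sqr /dot mulr_sumr -!big_split/=.
by apply: eq_bigr => i _; rewrite !mxE; ring.
Qed.

Lemma enorm_sqr_subZ (c : R) u v :
  enorm (u - c *: v) ^+ 2 =
    enorm u ^+ 2 - 2 * c * dot u v + c ^+ 2 * enorm v ^+ 2.
Proof.
rewrite !enorm_sqr /dot !mulr_sumr -sumrB -!big_split/=.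
by apply: eq_bigr => i _; rewrite !mxE; ring.
Qed.

Lemma enorm_sqrZ (c : R) u : enorm (c *: u) ^+ 2 = c ^+ 2 * enorm u ^+ 2.
Proof.
rewrite !enorm_sqr /dot mulr_sumr; apply: eq_bigr => i _.
by rewrite !mxE; ring.
Qed.

Lemma dot_scale_sumr {n : nat} (c : R) u (v : 'I_n -> 'rV[R]_d) :
  dot u (c *: \sum_j v j) = c * \sum_j dot u (v j).
Proof.
rewrite /dot exchange_big/= mulr_sumr; apply: eq_bigr => i _.
rewrite !mxE summxE !mulr_sumr; apply: eq_bigr => j _.
by rewrite mulrCA.
Qed.

(** By convexity |v|^2 lies above its linearization at u, whose linear term
    the Cauchy-Schwarz inequality bounds. *)
Lemma enorm_sqr_ge_perturb u v :
  enorm u ^+ 2 - 2 * (enorm u * enorm (v - u)) <= enorm v ^+ 2.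
Proof.
have := enorm_sqrD u (v - u); rewrite [u + _]addrC subrK => ->.
have := dot_le_enorm u (- (v - u)); rewrite dotNr enormN.
have := sqr_ge0 (enorm (v - u)); lra.
Qed.

Lemma enorm_sqrD_le u v :
  enorm (u + v) ^+ 2 <= 2 * enorm u ^+ 2 + 2 * enorm v ^+ 2.
Proof.
have := sqr_ge0 (enorm (u - v)).
by rewrite !enorm_sqrD dotNr enormN; lra.
Qed.

(** The topology of the space of vectors comes from the sup norm, so this
    comparison turns Euclidean Lipschitz bounds into continuity. *)
Lemma norm_le_enorm u : `|u| <= enorm u.
Proof.
rewrite [X in X <= _]/Num.norm/= mx_normrE; apply: bigmax_le => [|[i j] _/=].
  exact: enorm_ge0.
rewrite ord1 -sqrtr_sqr ler_wsqrtr// (bigD1 j)//= lerDl.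
by apply: sumr_ge0 => k _; exact: sqr_ge0.
Qed.

Lemma enorm_continuous : continuous (enorm : 'rV[R]_d -> R).
Proof.
move=> u; apply: (@continuous_comp _ _ _ _ Num.sqrt); last first.
  exact: sqrt_continuous.
apply: (@continuous_big _ _ _ 0 xpredT) => [|i _ {}u].
  exact: pseudometric_normed_Zmodule.add_continuous.
apply: (@continuous_comp _ _ _ (fun v : 'rV[R]_d => v 0 i) (fun x => x ^+ 2)).
  exact: coord_continuous.
exact: exprn_continuous.
Qed.

Lemma enorm_lipschitz_continuous (L : R) (g : 'rV[R]_d -> 'rV[R]_d) :
  (forall x y, enorm (g x - g y) <= L * enorm (x - y)) -> continuous g.
Proof.
move=> hL x; have FF := nbhs_filter x; apply/cvgrPdist_le => e e0 /=.
pose phi (y : 'rV[R]_d) : R := L * enorm (x - y).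
have phi0 : phi x = 0.
  rewrite /phi subrr /enorm big1 ?sqrtr0 ?mulr0// => i _.
  by rewrite mxE expr2 mulr0.
have : {for x, continuous phi}.
  apply: (@continuous_comp _ _ _ (fun y : 'rV[R]_d => enorm (x - y)) ( *%R L)).
    apply: (@continuous_comp _ _ _ (fun y : 'rV[R]_d => x - y) enorm).
      apply: (@continuousB _ _ _ (cst x) id x); first exact: cst_continuous.
      exact: cvg_id.
    exact: enorm_continuous.
  exact: mulrl_continuous.
move=> cphi; have : phi @ x --> (0 : R) by rewrite -phi0; exact: cphi.
move=> /cvgr0_norm_le /(_ e e0).
apply: filterS => y ye.
apply: le_trans (norm_le_enorm _) _; apply: le_trans (hL _ _) _.
exact: le_trans (ler_norm _) ye.
Qed.

End euclidean.

Lemma enorm_sub_sqr_continuous {R : realType} {d : nat} (m : 'rV[R]_d) :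
  continuous (fun x : 'rV[R]_d => enorm (x - m) ^+ 2).
Proof.
move=> x; apply: (@continuous_comp _ _ _ (fun y : 'rV[R]_d => enorm (y - m))
  (fun t => t ^+ 2)); last exact: exprn_continuous.
apply: (@continuous_comp _ _ _ (fun y : 'rV[R]_d => y - m) enorm).
  apply: (@continuousB _ _ _ id (cst m) x); first exact: cvg_id.
  exact: cst_continuous.
exact: enorm_continuous.
Qed.

Section gradient.
Context {R : realType} {d : nat}.

Lemma grad_average {J : nat} (f : 'I_J -> 'rV[R]_d -> R) x :
  (forall j, differentiable (f j) x) ->
  grad (average f) x = J%:R^-1 *: \sum_j grad (f j) x.
Proof.
move=> df; apply/rowP => i; rewrite !mxE summxE.
have fE : average f = J%:R^-1 \*: (\sum_(j < J) f j).
  by apply/funext => y; rewrite /average fct_sumE.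
have dv j : derivable (f j) x (delta_mx 0 i) by exact: diff_derivable.
rewrite fE deriveZ; last exact: derivable_sum.
rewrite derive_sum//; congr (_ *: _).
by apply: eq_bigr => j _; rewrite mxE.
Qed.

Lemma grad_eq0_at_min (f : 'rV[R]_d -> R) (m : 'rV[R]_d) :
  (forall x, differentiable f x) -> (forall x, f m <= f x) -> grad f m = 0.
Proof.
move=> df hm; apply/rowP => i; rewrite !mxE.
set v := delta_mx 0 i.
pose g (t : R) := f (m + t *: v).
have dg t : derivable g t 1.
  apply/derivable1_diffP.
  apply: (@differentiable_comp _ _ _ _ (fun t : R => m + t *: v) f) => //.
have [|||t _|_ g'0] := @derive1_at_min _ g (-1) 1 0.
- by lra.
- by move=> t _; exact: dg.
- by rewrite in_itv/=; lra.
- by rewrite /g scale0r addr0; exact: hm.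
(* The quotients of f at m along v are those of g at 0. *)
rewrite -[RHS]g'0 /derive.
suff -> : (fun h => h^-1 *: ((f \o shift m) (h *: v) - f m)) =
    (fun h => h^-1 *: ((g \o shift 0) (h *: 1) - g 0)) by [].
apply/funext => h; rewrite /g/=.
by rewrite scale0r !addr0 [m + _]addrC [h *: 1]mulr1.
Qed.

End gradient.

(** * One step of the iteration *)

Section rms.
Context {R : realType} {J : nat}.
Implicit Types a b : 'I_J -> R.

Lemma rms_ge0 a : 0 <= rms a.
Proof. exact: sqrtr_ge0. Qed.

Lemma rms_sqr a : rms a ^+ 2 = J%:R^-1 * \sum_j a j ^+ 2.
Proof.
rewrite sqr_sqrtr// mulr_ge0 ?invr_ge0// sumr_ge0// => j _; exact: sqr_ge0.
Qed.

Lemma mean_mul_le_rms a b : J%:R^-1 * \sum_j a j * b j <= rms a * rms b.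
Proof.
rewrite /rms !sqrtrM ?invr_ge0// mulrACA -expr2 sqr_sqrtr ?invr_ge0//.
by rewrite ler_wpM2l ?invr_ge0//; exact: sum_CauchySchwarz.
Qed.

Lemma mean_const (c : R) : (0 < J)%N -> J%:R^-1 * \sum_(j < J) c = c.
Proof.
move=> J0; rewrite sumr_const card_ord -[c *+ J]mulr_natl mulKf//.
by rewrite pnatr_eq0 -lt0n.
Qed.

End rms.

Section sgd_step.
Context {R : realType} {d J : nat}.
Variables (f : 'I_J -> 'rV[R]_d -> R) (m : 'rV[R]_d) (eta : R).

Definition sgd_step (j : 'I_J) (x : 'rV[R]_d) : 'rV[R]_d :=
  x - eta *: grad (f j) x.

(** The gradient of the average vanishes at the minimizer m, so the drift term
    is quadratic in the distance to m, and the gradients of the summands stay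
    close to their values at m; the Cauchy-Schwarz inequality over j bounds the
    mean of the products of lambda_j and |grad f_j(m)|. *)
Lemma mean_sqr_sgd_step_ge (lambda0 : R) (lambda : 'I_J -> R) (x : 'rV[R]_d) :
  (0 < J)%N -> 0 <= eta ->
  (forall j y, differentiable (f j) y) ->
  (forall y, average f m <= average f y) ->
  grad_lipschitz (average f) lambda0 ->
  (forall j, grad_lipschitz (f j) (lambda j)) ->
  (1 - 2 * eta * lambda0) * enorm (x - m) ^+ 2
    - 2 * (eta ^+ 2 * rms lambda * rms (fun j => enorm (grad (f j) m)))
      * enorm (x - m)
    + eta ^+ 2 * rms (fun j => enorm (grad (f j) m)) ^+ 2
  <= J%:R^-1 * \sum_j enorm (sgd_step j x - m) ^+ 2.
Proof.
move=> J0 eta0 df hmin hL0 hL.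
set D0 := rms (fun j => enorm _); set r := enorm (x - m).
have davg y : differentiable (average f) y.
  have -> : average f = J%:R^-1 \*: (\sum_(j < J) f j).
    by apply/funext => z; rewrite /average fct_sumE.
  by apply: differentiableZ; exact: differentiable_sum.
set G := grad (average f) x.
have drift : dot (x - m) G <= lambda0 * r ^+ 2.
  have := hL0 x m; rewrite (grad_eq0_at_min _ m davg hmin) subr0 => hG.
  apply: (le_trans (dot_le_enorm _ _)).
  by rewrite expr2 mulrCA ler_wpM2l ?enorm_ge0.
set S := J%:R^-1 * \sum_j enorm (grad (f j) x) ^+ 2.
have noise : D0 ^+ 2 - 2 * (rms lambda * D0) * r <= S.
  rewrite rms_sqr.
  have /(ler_wpM2r (enorm_ge0 (x - m))) :=
    mean_mul_le_rms lambda (fun j => enorm (grad (f j) m)).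
  rewrite -/D0 -/r => hCS.
  apply: (@le_trans _ _ (J%:R^-1 * \sum_j enorm (grad (f j) m) ^+ 2 -
      2 * (J%:R^-1 * (\sum_j lambda j * enorm (grad (f j) m)) * r))).
    by lra.
  rewrite -mulrA [2 * _]mulrCA -mulrBr ler_wpM2l ?invr_ge0//.
  rewrite mulr_suml mulr_sumr -sumrB; apply: ler_sum => j _.
  apply: (le_trans _ (enorm_sqr_ge_perturb (grad (f j) m) (grad (f j) x))).
  rewrite lerD2l lerN2 ler_wpM2l// mulrAC.
  by rewrite mulrC ler_wpM2r ?enorm_ge0//; exact: hL.
have -> : J%:R^-1 * \sum_j enorm (sgd_step j x - m) ^+ 2 =
    r ^+ 2 - 2 * eta * dot (x - m) G + eta ^+ 2 * S.
  rewrite -[X in _ = X - _ + _](mean_const _ J0) /G.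
  rewrite grad_average// dot_scale_sumr.
  rewrite [2 * eta * _]mulrCA [eta ^+ 2 * _]mulrCA -mulrBr -mulrDr.
  congr (_ * _).
  rewrite !mulr_sumr -sumrB -big_split/=; apply: eq_bigr => j _.
  by rewrite /sgd_step addrAC enorm_sqr_subZ.
have := ler_wpM2l (sqr_ge0 eta) noise.
have := ler_wpM2l eta0 drift.
nra.
Qed.

(** The constants are crude: the bound only serves to show that the mean square
    error stays finite along the iteration. *)
Lemma mean_sqr_sgd_step_le (lambda : 'I_J -> R) (x : 'rV[R]_d) :
  (0 < J)%N -> (forall j, grad_lipschitz (f j) (lambda j)) ->
  J%:R^-1 * \sum_j enorm (sgd_step j x - m) ^+ 2 <=
    (2 + 4 * eta ^+ 2 * rms lambda ^+ 2) * enorm (x - m) ^+ 2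
    + 4 * eta ^+ 2 * rms (fun j => enorm (grad (f j) m)) ^+ 2.
Proof.
move=> J0 hL; set r := enorm (x - m).
rewrite !rms_sqr.
rewrite [X in _ <= X](_ : _ = J%:R^-1 * \sum_j (2 * r ^+ 2 +
   (4 * eta ^+ 2 * r ^+ 2) * lambda j ^+ 2 +
   (4 * eta ^+ 2) * enorm (grad (f j) m) ^+ 2)).
  rewrite ler_wpM2l ?invr_ge0//; apply: ler_sum => j _.
  rewrite /sgd_step addrAC.
  apply: (le_trans (enorm_sqrD_le _ _)); rewrite -/r -addrA lerD2l.
  rewrite enormN enorm_sqrZ.
  have := enorm_sqrD_le (grad (f j) x - grad (f j) m) (grad (f j) m).
  rewrite subrK.
  have : enorm (grad (f j) x - grad (f j) m) ^+ 2 <= (lambda j * r) ^+ 2.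
    rewrite ler_sqr ?nnegrE ?enorm_ge0 ?hL//.
    exact: le_trans (enorm_ge0 _) (hL j x m).
  rewrite exprMn.
  have := sqr_ge0 eta.
  set u := eta ^+ 2; set p := enorm _ ^+ 2; set q := enorm _ ^+ 2.
  nra.
rewrite !big_split/= !mulrDr mean_const// -!mulr_sumr; ring.
Qed.

End sgd_step.

Lemma sgd_step_continuous {R : realType} {d J : nat}
    (f : 'I_J -> 'rV[R]_d -> R) (eta : R) (L : R) (j : 'I_J) :
  grad_lipschitz (f j) L -> continuous (sgd_step f eta j).
Proof.
move=> hL x; apply: (@continuousB _ _ _ id (fun y => eta *: grad (f j) y) x).
  exact: cvg_id.
apply: (@continuous_comp _ _ _ (grad (f j)) ( *:%R eta)).
  exact: enorm_lipschitz_continuous hL x.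
exact: scaler_continuous.
Qed.

(** * The error floor and the affine minorant of one step *)

Section error_floor.
Context {R : realType} (eta lambda0 Lambda D0 : R).
Hypotheses (eta_gt0 : 0 < eta) (lambda0_gt0 : 0 < lambda0).
Let z0 := error_floor eta lambda0 Lambda D0.

(** The floor is a solution of q(z) = z^2, here divided by eta, where q is the
    quadratic lower bound of [mean_sqr_sgd_step_ge]. *)
Lemma error_floor_root :
  2 * lambda0 * z0 ^+ 2 + 2 * eta * Lambda * D0 * z0 = eta * D0 ^+ 2.
Proof.
rewrite /z0 /error_floor; set q := (X in Num.sqrt X); set s := Num.sqrt q.
have q0 : 0 <= q.
  have -> : q = (2 * eta * Lambda * D0) ^+ 2 + 8 * (eta * lambda0) * D0 ^+ 2.
    by rewrite /q; ring.
  by rewrite addr_ge0 ?sqr_ge0// mulr_ge0 ?sqr_ge0// mulr_ge0 ?mulr_ge0// ltW.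
have sE : s ^+ 2 = q by rewrite sqr_sqrtr.
have l0 : lambda0 != 0 by rewrite gt_eqF.
have -> : 2 * lambda0 * ((- (2 * eta * Lambda * D0) + s) / (4 * lambda0)) ^+ 2
    + 2 * eta * Lambda * D0 * ((- (2 * eta * Lambda * D0) + s) / (4 * lambda0))
  = (s ^+ 2 - (2 * eta * Lambda * D0) ^+ 2) / (8 * lambda0) by field.
by rewrite sE /q; field.
Qed.

Lemma error_floor_gt0 : 0 < D0 -> 0 <= Lambda -> 0 < z0.
Proof.
move=> D00 L0; rewrite divr_gt0 ?mulr_gt0// addrC subr_gt0.
set u := _ * D0; have u0 : 0 <= u.
  by rewrite /u !mulr_ge0// ltW.
rewrite -[X in X < _](ger0_norm u0) -sqrtr_sqr ltr_sqrt.
  rewrite (_ : u ^+ 2 = 4 * eta ^+ 2 * Lambda ^+ 2 * D0 ^+ 2); last first.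
    by rewrite /u; ring.
  by rewrite ltrDl !mulr_gt0// exprn_gt0.
have h : 0 < 8 * eta * lambda0 * D0 ^+ 2 by rewrite !mulr_gt0// exprn_gt0.
by move: (ltW eta_gt0) (ltW D00) => ? ?; rewrite ltr_wpDl// !mulr_ge0.
Qed.

Lemma error_floor0 : D0 = 0 -> z0 = 0.
Proof.
move=> D00; rewrite /z0 /error_floor D00 expr0n/=.
by rewrite !mulr0 addr0 sqrtr0 oppr0 addr0 mul0r.
Qed.

(** The coefficient of r^2 in q(r) after 2 r is replaced by r^2 / z0 + z0. *)
Definition error_rate : R :=
  1 - 2 * eta * lambda0 - eta ^+ 2 * Lambda * D0 / z0.

(** The difference of the two sides is (eta^2 Lambda D0 / z0) (r - z0)^2: both
    have the same value and the same slope at r = z0. *)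
Lemma error_rate_tangent (r : R) : 0 <= D0 -> 0 <= Lambda -> 0 < z0 ->
  error_rate * r ^+ 2 + (1 - error_rate) * z0 ^+ 2 <=
  (1 - 2 * eta * lambda0) * r ^+ 2 - 2 * (eta ^+ 2 * Lambda * D0) * r
    + eta ^+ 2 * D0 ^+ 2.
Proof.
move=> D00 L0 z00; rewrite -subr_ge0.
have -> : eta ^+ 2 * D0 ^+ 2 = eta * (eta * D0 ^+ 2) by ring.
rewrite -error_floor_root.
have zN0 : z0 != 0 by rewrite gt_eqF.
rewrite [X in 0 <= X](_ : _ = eta ^+ 2 * Lambda * D0 / z0 * (r - z0) ^+ 2).
  by rewrite mulr_ge0 ?sqr_ge0// divr_ge0 ?(ltW z00)// !mulr_ge0// ltW.
by rewrite /error_rate; field.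
Qed.

Lemma error_rate_lt1 : 0 <= D0 -> 0 <= Lambda -> 0 < z0 -> error_rate < 1.
Proof.
move=> D00 L0 z00; rewrite /error_rate.
have : 0 < eta * lambda0 by rewrite mulr_gt0.
have : 0 <= eta ^+ 2 * Lambda * D0 / z0.
  by rewrite divr_ge0 ?(ltW z00)// !mulr_ge0// ltW.
lra.
Qed.

(** The step-size condition places the vertex of the parabola q to the left of
    z0, where q and its affine minorant have the same slope. *)
Lemma error_rate_ge0 : 0 < z0 -> 0 < 1 - 2 * eta * lambda0 ->
  eta ^+ 2 * Lambda * D0 / (1 - 2 * eta * lambda0) <= z0 -> 0 <= error_rate.
Proof.
move=> z00 b0; rewrite ler_pdivrMr// => h.
by rewrite /error_rate subr_ge0 ler_pdivrMr// [_ * z0]mulrC.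
Qed.

End error_floor.

(** * Lower limits of affine recursive inequalities *)

Section affine_recursion.
Context {R : realType} (r : nat -> R) (a L : R).
Hypotheses (a_lt1 : a < 1)
  (hr : forall k, a * r k + (1 - a) * L <= r k.+1).

(** While r stays below some M < L, each step adds at least (1 - a) (L - M),
    which a sequence bounded by M cannot do forever; this leaves room for a
    negative rate a. *)
Lemma affine_recursion_limn_esup : (forall k, 0 <= r k) ->
  (L%:E <= limn_esup (fun k => (r k)%:E))%E.
Proof.
move=> r0; set u := fun k => (r k)%:E.
rewrite limn_esup_lim (cvg_lim (@ereal_hausdorff R) (@cvg_esups_inf R u)) leNgt.
apply/negP.
move=> /ereal_inf_lt[_ [n _ <-]] ltL.
have le_esups k : (n <= k)%N -> (u k <= esups u n)%E.
  by move=> nk; apply: ereal_sup_ubound; exists k.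
have [M esE] : exists M, esups u n = M%:E.
  exists (fine (esups u n)); rewrite fineK// fin_real//.
  by rewrite (lt_le_trans _ (le_esups n _)) ?ltNyr//= (lt_trans ltL) ?ltry.
rewrite esE lte_fin in ltL.
have rM k : (n <= k)%N -> r k <= M.
  by move=> /le_esups; rewrite esE lee_fin.
pose c := (1 - a) * (L - M).
have c0 : 0 < c by rewrite mulr_gt0// subr_gt0.
have grow k : c *+ k <= r (n + k)%N.
  elim: k => [|k IH]; first by rewrite mulr0n.
  rewrite addnS mulrSr; apply: le_trans (hr _).
  have := rM _ (leq_addr k n).
  have : 0 < 1 - a by rewrite subr_gt0.
  rewrite /c in IH *; nra.
have M0 : 0 <= M / c by rewrite divr_ge0 ?(ltW c0)// (le_trans (r0 n)) ?rM.
have := archi_boundP M0; set k := Num.Def.archi_bound _.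
rewrite ltr_pdivrMr// mulr_natl ltNge => /negP; apply.
by rewrite (le_trans (grow k))// rM// leq_addr.
Qed.

(** The gap L - r_k is contracted by the nonnegative factor a at each step. *)
Lemma affine_recursion_limn_einf : 0 <= a ->
  (L%:E <= limn_einf (fun k => (r k)%:E))%E.
Proof.
move=> a0; set u := fun k => (r k)%:E.
rewrite limn_einf_lim (cvg_lim (@ereal_hausdorff R) (@cvg_einfs_sup R u)).
have gap k : L - r k <= a ^+ k * (L - r 0%N).
  elim: k => [|k IH]; first by rewrite expr0 mul1r.
  have := ler_wpM2l a0 IH; rewrite mulrA -exprS; have := hr k; lra.
have geo : (fun k => a ^+ k * (L - r 0%N)) @ \oo --> (0 : R).
  rewrite -[X in _ --> X](mul0r (L - r 0%N)); apply: cvgM; last exact: cvg_cst.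
  by apply: cvg_expr; rewrite ger0_norm.
apply/lee_addgt0Pr => e e0.
have [N _ hN] := cvgr0_norm_le _ geo _ e0.
apply: (@le_trans _ _ (einfs u N + e%:E)%E); last first.
  by rewrite leeD2r//; apply: ereal_sup_ubound; exists N.
rewrite -leeBlDr//; apply: le_ereal_inf_tmp => _ [k /= Nk <-].
rewrite -EFinB lee_fin.
have := hN k Nk; rewrite /= => /(le_trans (ler_norm _)).
have := gap k; lra.
Qed.

End affine_recursion.

(** * Integrals of random variables *)

Lemma continuous_borel_preimage {R : realType} {d : nat} (h : 'rV[R]_d -> R)
    (B : set R) :
  continuous h -> measurable B -> borel (h @^-1` B).
Proof.
move=> /continuousP ch mB.
pose T := g_sigma_algebraType [set A : set 'rV[R]_d | open A].
have mh : measurable_fun [set: T] (h : T -> R).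
  apply: (measurability _ (RGenOpens.measurableE R)).
  move=> _ [_ [a [b ->] <-]]; rewrite setTI.
  by apply: sub_sigma_algebra => /=; exact/ch/interval_open.
by have := mh measurableT B mB; rewrite setTI.
Qed.

Section integral_independent.
Context {disp : measure_display} {T : measurableType disp} {R : realType}.
Variable P : probability T R.
Local Open Scope ereal_scope.

(** Both sides are integrals of the identity over the nonnegative half-line:
    against the law of X restricted to A, and against the law of X scaled by
    P A; independence says that these measures agree. *)
Lemma integral_independent_event (X : T -> R) (A : set T) :
  measurable_fun setT X -> (forall w, 0 <= X w)%R -> measurable A ->
  (forall B, measurable B -> P (X @^-1` B `&` A) = P (X @^-1` B) * P A) ->
  \int[P]_(w in A) (X w)%:E = P A * \int[P]_w (X w)%:E.
Proof.
move=> mX X0 mA ind.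
(* The value -1 sends the complement of A outside the half-line D, so that the
   law of phi on D is the law of X restricted to A. *)
pose phi w := if w \in A then X w else (-1)%R.
have mphi : measurable_fun setT phi.
  apply: measurable_fun_ifT => //.
  apply: (measurable_fun_bool true); rewrite setTI.
  rewrite (_ : _ @^-1` _ = A)//.
  by apply/seteqP; split => w /=; [exact: set_mem|exact: mem_set].
pose D : set R := `[0%R, +oo[%classic.
have mD : measurable D by exact: measurable_itv.
have phiD (B : set R) : B `<=` D -> phi @^-1` B = X @^-1` B `&` A.
  move=> BD; apply/seteqP; split => w /=; rewrite /phi.
    case: ifPn => [/set_mem|_ /BD]; first by [].
    by rewrite /D/= in_itv/= andbT => ?; exfalso; lra.
  by move=> [Bw Aw]; rewrite mem_set.
have XD : X @^-1` D = setT.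
  by apply/seteqP; split => w //= _; rewrite /D/= in_itv/= X0.
have phiDA : phi @^-1` D = A by rewrite phiD// XD setTI.
have mE := @EFin_measurable R D.
have E0 : {in D, forall y : R, 0 <= y%:E}.
  by move=> y; rewrite inE /D/= in_itv/= andbT lee_fin.
rewrite -{1}phiDA.
transitivity (\int[P]_(w in phi @^-1` D) (EFin \o phi) w).
  apply: eq_integral => w; rewrite phiDA => wA /=.
  by rewrite /phi wA.
rewrite -(ge0_integral_pushforward mphi)//.
have k0 : (0 <= fine (P A))%R by exact: fine_ge0.
have PAE : P A = (NngNum k0)%:num%:E by rewrite /= fineK ?fin_num_measure.
rewrite -XD PAE -(ge0_integral_pushforward mX P mD mE E0).
rewrite -ge0_integral_mscale//; last first.
  by move=> y Dy; apply: E0; rewrite inE.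
apply: eq_measure_integral => B mB BD.
rewrite /= /pushforward /mscale/= phiD// ind// fineK ?fin_num_measure//.
by rewrite muleC.
Qed.

End integral_independent.

Section affine_integral.
Context {disp : measure_display} {T : measurableType disp} {R : realType}.
Variables (P : probability T R) (X Y : T -> R).
Hypotheses (mX : measurable_fun setT X) (mY : measurable_fun setT Y).
Hypotheses (X0 : forall w, 0 <= X w) (Y0 : forall w, 0 <= Y w).
Local Open Scope ereal_scope.

Let integrable_ge0 (Z : T -> R) : measurable_fun setT Z ->
  (forall w, (0 <= Z w)%R) -> \int[P]_w (Z w)%:E < +oo ->
  P.-integrable setT (EFin \o Z).
Proof.
move=> mZ Z0 Zoo; apply/integrableP; split; first exact/measurable_EFinP.
by under eq_integral do rewrite /= ger0_norm//.
Qed.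

Let integrable_affine (a b : R) : \int[P]_w (X w)%:E < +oo ->
  P.-integrable setT (fun w => (a * X w + b)%:E).
Proof.
move=> Xoo; have iX := integrable_ge0 X mX X0 Xoo.
rewrite (_ : (fun w => _) = (fun w => a%:E * (EFin \o X) w + (cst b%:E) w)) //.
apply: integrableD => //; first exact: integrableZl.
exact: finite_measure_integrable_cst.
Qed.

Let integral_affine (a b : R) : \int[P]_w (X w)%:E < +oo ->
  \int[P]_w (a * X w + b)%:E = (a * fine (\int[P]_w (X w)%:E) + b)%:E.
Proof.
move=> Xoo; have iX := integrable_ge0 X mX X0 Xoo.
under eq_integral do rewrite EFinD EFinM.
rewrite integralD//; last 2 first.
- exact: integrableZl.
- exact: finite_measure_integrable_cst.
rewrite integralZl// integral_cst//.
rewrite [X in _ + _ * X](_ : _ = 1); last exact: probability_setT.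
rewrite mule1.
by rewrite -[X in _ * X + _]fineK ?integrable_fin_num.
Qed.

Lemma integral_lty_affine (a b : R) : (forall w, Y w <= a * X w + b)%R ->
  \int[P]_w (X w)%:E < +oo -> \int[P]_w (Y w)%:E < +oo.
Proof.
move=> hY Xoo.
apply: (@le_lt_trans _ _ (\int[P]_w (a * X w + b)%:E)).
  apply: ge0_le_integral => //.
  - by move=> w _; rewrite lee_fin.
  - exact/measurable_EFinP.
  - exact: (measurable_int _ (integrable_affine a b Xoo)).
  - by move=> w _; rewrite lee_fin.
by rewrite integral_affine// ltry.
Qed.

Lemma fine_integral_affine_le (a b : R) : (forall w, a * X w + b <= Y w)%R ->
  \int[P]_w (X w)%:E < +oo -> \int[P]_w (Y w)%:E < +oo ->
  (a * fine (\int[P]_w (X w)%:E) + b <= fine (\int[P]_w (Y w)%:E))%R.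
Proof.
move=> hY Xoo Yoo.
have iY := integrable_ge0 Y mY Y0 Yoo.
rewrite -lee_fin fineK ?integrable_fin_num// -integral_affine//.
apply: le_integral => //; first exact: integrable_affine.
by move=> w _; rewrite lee_fin.
Qed.

End affine_integral.

(** * Cylinder events of the index sequence *)

(** The indices range over a finite set of the type in which mutual
    independence is stated, so that the latter applies directly. *)
Definition cylinder {T : Type} {J : nat} (gamma : nat -> T -> 'I_J)
    (k n : nat) (a : nat -> 'I_J) : set T :=
  \bigcap_(i in [set` [fset i in iota k n]%fset]) gamma i @^-1` [set a i].

Section cylinder.
Context {disp : measure_display} {T : measurableType disp} {R : realType}.
Variables (P : probability T R) (J : nat) (gamma : nat -> T -> 'I_J).
Hypothesis hgamma : iid_uniform P gamma.

Lemma cylinder0 k a : cylinder gamma k 0 a = setT.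
Proof. by apply/seteqP; split => // w _ i /=; rewrite !inE. Qed.

Lemma cylinderS k n a :
  cylinder gamma k n.+1 a = gamma k @^-1` [set a k] `&` cylinder gamma k.+1 n a.
Proof.
apply/seteqP; split => w /=.
  move=> h; split => [|i /=]; first by apply: h; rewrite /= !inE/= eqxx.
  by rewrite !inE/= => ik; apply: h; rewrite /= !inE/= ik orbT.
move=> [wk h] i /=; rewrite !inE/= => /orP[/eqP->//|ik].
by apply: h; rewrite /= !inE.
Qed.

Lemma cylinder_eq k n a b : (forall i, (k <= i)%N -> a i = b i) ->
  cylinder gamma k n a = cylinder gamma k n b.
Proof.
move=> ab; apply: eq_bigcapr => i /=; rewrite !inE mem_iota => /andP[ki _].
by rewrite ab.
Qed.

Lemma measurable_preimage_index k (B : set 'I_J) : measurable (gamma k @^-1` B).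
Proof.
by case: hgamma => + _ _ => /(_ k); apply; exists B => //; rewrite setTI.
Qed.

Lemma measurable_cylinder k n a : measurable (cylinder gamma k n a).
Proof.
apply: bigcap_measurableType => i _; exact: measurable_preimage_index.
Qed.

Lemma sigma_gen_seq_cylinder k n a :
  sigma_gen_seq gamma discrete_measurable (cylinder gamma k n a).
Proof.
pose S := g_sigma_algebraType
  (\bigcup_k sigma_gen (gamma k) discrete_measurable).
apply: (@bigcap_measurableType _ S) => i _.
apply: sub_sigma_algebra; exists i => //.
by exists [set a i] => //; rewrite setTI.
Qed.

Lemma probability_cylinder k n a :
  P (cylinder gamma k n a) = (J%:R^-1 ^+ n)%:E.
Proof.
case: hgamma => _ ind unif.
rewrite ind; last by move=> i _; exists [set a i] => //; rewrite setTI.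
under eq_bigr do rewrite unif.
rewrite prodEFin big_const_seq count_predT iter_mulr_1.
by rewrite [size _](card_fseq (iota k n)) undup_id ?iota_uniq// size_iota.
Qed.

End cylinder.

(** * Independence of the iterates from the future indices *)

Section sgd.
Context {disp : measure_display} {T : measurableType disp} {R : realType}.
Variables (P : probability T R) (d J : nat).
Variables (f : 'I_J -> 'rV[R]_d -> R) (eta : R).
Variables (gamma : nat -> T -> 'I_J) (theta : nat -> T -> 'rV[R]_d).
Hypothesis step_continuous : forall j, continuous (sgd_step f eta j).
Hypothesis hgamma : iid_uniform P gamma.
Hypothesis mtheta0 : sigma_gen (theta 0%N) borel `<=` measurable.
Hypothesis hindep : independent P (sigma_gen (theta 0%N) borel)
                      (sigma_gen_seq gamma discrete_measurable).
Hypothesis hsgd : sgd f eta gamma theta.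

Lemma sgd_succ k w : theta k.+1 w = sgd_step f eta (gamma k w) (theta k w).
Proof. exact: hsgd. Qed.

Lemma continuous_step (h : 'rV[R]_d -> R) j :
  continuous h -> continuous (h \o sgd_step f eta j).
Proof.
by move=> ch x; apply: continuous_comp; [exact: step_continuous|exact: ch].
Qed.

Lemma bigsetU_index k (D : set T) :
  D = \big[setU/set0]_(j < J) (gamma k @^-1` [set j] `&` D).
Proof.
rewrite -bigcup_seq; apply/seteqP; split => w; last by move=> [j _ []].
by move=> Dw; exists (gamma k w) => //=; exact: mem_index_enum.
Qed.

(** On each event {gamma_k = j} the next iterate is a continuous function of
    the current one. *)
Lemma measurable_continuous_sgd k (h : 'rV[R]_d -> R) : continuous h ->
  measurable_fun setT (fun w => h (theta k w)).
Proof.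
elim: k h => [|k IH] h ch _ B mB; rewrite setTI.
  apply: mtheta0; exists (h @^-1` B); first exact: continuous_borel_preimage.
  by rewrite setTI.
rewrite (bigsetU_index k (_ @^-1` B)); apply: bigsetU_measurable => j _.
rewrite (_ : _ `&` _ = gamma k @^-1` [set j] `&`
    (fun w => (h \o sgd_step f eta j) (theta k w)) @^-1` B).
  apply: measurableI; first exact: (measurable_preimage_index _ _ _ hgamma).
  rewrite -[X in measurable X]setTI; apply: IH => //; exact: continuous_step.
by apply/seteqP; split => w /= [jw]; rewrite sgd_succ jw.
Qed.

Lemma integral_split_index k (D : set T) (X : T -> \bar R) :
  measurable D -> measurable_fun D X -> (forall w, (0 <= X w)%E) ->
  (\int[P]_(w in D) X w =
   \sum_(j < J) \int[P]_(w in gamma k @^-1` [set j] `&` D) X w)%E.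
Proof.
move=> mD mX X0.
rewrite {1}(bigsetU_index k D) ge0_integral_bigsetU//.
- move=> j; apply: measurableI => //.
  exact: (measurable_preimage_index _ _ _ hgamma).
- exact: index_enum_uniq.
- by move=> i j _ _ [w [[<- _] [<- _]]].
- by rewrite -bigsetU_index.
Qed.

(** Independence of theta_k from the events on gamma_k, gamma_{k+1}, ... as
    nonnegative continuous observables and cylinder events see it. *)
Definition future_independent k := forall n a (h : 'rV[R]_d -> R),
  continuous h -> (forall x, 0 <= h x) ->
  (\int[P]_(w in cylinder gamma k n a) (h (theta k w))%:E =
   P (cylinder gamma k n a) * \int[P]_w (h (theta k w))%:E)%E.

(** Splitting along the value j of gamma_k turns a cylinder of length m at time
    k + 1 into cylinders of length m + 1 at time k, where the next iterate is
    the j-th step from theta_k. *)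
Lemma integral_sgd_succ_cylinder k m b (h : 'rV[R]_d -> R) :
  future_independent k -> continuous h -> (forall x, 0 <= h x) ->
  (\int[P]_(w in cylinder gamma k.+1 m b) (h (theta k.+1 w))%:E =
    \sum_(j < J) (J%:R^-1 ^+ m.+1)%:E *
       \int[P]_w (h (sgd_step f eta j (theta k w)))%:E)%E.
Proof.
move=> ind ch h0; rewrite (integral_split_index k); last 3 first.
- exact: (measurable_cylinder _ _ _ hgamma).
- apply/measurable_EFinP; apply: measurable_funTS.
  exact: measurable_continuous_sgd.
- by move=> w; rewrite lee_fin.
apply: eq_bigr => j _.
(* The constraint on gamma_k becomes the first letter of the longer word. *)
pose b' i := if i == k then j else b i.
have bE : gamma k @^-1` [set j] `&` cylinder gamma k.+1 m b =
    cylinder gamma k m.+1 b'.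
  rewrite cylinderS /b' eqxx; congr (_ `&` _).
  by apply: cylinder_eq => i ki; rewrite gtn_eqF.
rewrite -(probability_cylinder _ _ _ hgamma k m.+1 b').
have <- := ind m.+1 b' _ (continuous_step h j ch) (fun x => h0 _).
rewrite bE; apply: eq_integral => w; rewrite inE cylinderS => -[wk _].
by rewrite sgd_succ wk /b' eqxx.
Qed.

(** At time 0 this is the independence of theta_0 from the whole sequence of
    indices.  In the inductive step the cylinder enters
    [integral_sgd_succ_cylinder] only through a factor J^-n, which is its
    probability, and the empty cylinder identifies the remaining sum. *)
Lemma future_independent_sgd k : future_independent k.
Proof.
elim: k => [|k IH] n a h ch h0.
  apply: integral_independent_event => //.
  - exact: measurable_continuous_sgd.
  - exact: (measurable_cylinder _ _ _ hgamma).
  - move=> B mB; apply: hindep; last exact: sigma_gen_seq_cylinder.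
    exists (h @^-1` B); first exact: continuous_borel_preimage.
    by rewrite setTI.
have := integral_sgd_succ_cylinder k 0 a h IH ch h0.
rewrite cylinder0 integral_sgd_succ_cylinder// => ->.
rewrite (probability_cylinder _ _ _ hgamma) ge0_sume_distrr; last first.
  move=> j _; rewrite mule_ge0 ?lee_fin ?exprn_ge0 ?invr_ge0//.
  by apply: integral_ge0 => w _; rewrite lee_fin.
by apply: eq_bigr => j _; rewrite muleA -EFinM expr1 exprSr.
Qed.

(** The Markov property of the iteration: one step averages the observable over
    the J possible steps. *)
Lemma integral_sgd_succ k (h : 'rV[R]_d -> R) : (0 < J)%N ->
  continuous h -> (forall x, 0 <= h x) ->
  (\int[P]_w (h (theta k.+1 w))%:E =
   \int[P]_w (J%:R^-1 * \sum_(j < J) h (sgd_step f eta j (theta k w)))%:E)%E.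
Proof.
move=> J0 ch h0.
have := integral_sgd_succ_cylinder k 0 (fun=> Ordinal J0) h
  (future_independent_sgd k) ch h0.
rewrite cylinder0 expr1 => ->.
have ch' j := continuous_step h j ch.
under [RHS]eq_integral do rewrite EFinM -sumEFin.
rewrite ge0_integralZl_EFin ?invr_ge0//; last 2 first.
- by move=> w _; apply: sume_ge0 => j _; rewrite lee_fin.
- apply: emeasurable_sum => j; apply/measurable_EFinP.
  exact: (measurable_continuous_sgd k _ (ch' j)).
rewrite ge0_integral_sum//; last 2 first.
- move=> j; apply/measurable_EFinP.
  exact: (measurable_continuous_sgd k _ (ch' j)).
- by move=> j w _; rewrite lee_fin.
rewrite ge0_sume_distrr// => j _.
by apply: integral_ge0 => w _; rewrite lee_fin.
Qed.

End sgd.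

(** * The lower bounds on the error *)

Theorem theorem3p3 (disp : measure_display) (Omega : measurableType disp)
    (R : realType) (P : probability Omega R) (d J : nat)
    (hd : (1 <= d)%N) (hJ : (1 <= J)%N)
    (f : 'I_J -> 'rV[R]_d -> R)
    (hdiff : forall (j : 'I_J) (x : 'rV[R]_d), differentiable (f j) x)
    (theta_min : 'rV[R]_d)
    (hmin : forall x : 'rV[R]_d, average f theta_min <= average f x)
    (lambda0 : R) (lambda : 'I_J -> R)
    (hlambda0 : 0 < lambda0) (hlambda : forall j : 'I_J, 0 < lambda j)
    (hsmooth0 : grad_lipschitz (average f) lambda0)
    (hsmooth : forall j : 'I_J, grad_lipschitz (f j) (lambda j))
    (eta : R) (heta0 : 0 < eta) (heta : eta < 1 / (2 * lambda0))
    (gamma : nat -> Omega -> 'I_J) (hgamma : iid_uniform P gamma)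
    (theta : nat -> Omega -> 'rV[R]_d)
    (htheta0 : sigma_gen (theta 0%N) borel `<=` measurable)
    (hindep : independent P (sigma_gen (theta 0%N) borel)
                            (sigma_gen_seq gamma discrete_measurable))
    (htheta0_fin : (mean_sq_error P theta_min theta 0%N < +oo)%E)
    (hsgd : sgd f eta gamma theta) :
  let D0 := rms (fun j : 'I_J => enorm (grad (f j) theta_min)) in
  let Lambda := rms lambda in
  let z0 := error_floor eta lambda0 Lambda D0 in
  ((z0 ^+ 2)%:E <= limn_esup (mean_sq_error P theta_min theta))%E /\
  (eta ^+ 2 * Lambda * D0 / (1 - 2 * eta * lambda0) <= z0 ->
   ((z0 ^+ 2)%:E <= limn_einf (mean_sq_error P theta_min theta))%E).
Proof.
move=> D0 Lambda z0.
pose h (x : 'rV[R]_d) : R := enorm (x - theta_min) ^+ 2.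
have ch : continuous h by exact: enorm_sub_sqr_continuous.
have h0 x : 0 <= h x by exact: sqr_ge0.
have cstep j : continuous (sgd_step f eta j).
  exact: sgd_step_continuous (hsmooth j).
have mh k (g : 'rV[R]_d -> R) : continuous g ->
    measurable_fun setT (fun w => g (theta k w)).
  exact: (measurable_continuous_sgd _ _ _ _ _ _ _ cstep hgamma htheta0 hsgd).
pose Y k w := J%:R^-1 * \sum_j h (sgd_step f eta j (theta k w)).
have Y0 k w : 0 <= Y k w by rewrite mulr_ge0 ?invr_ge0// sumr_ge0.
have mY k : measurable_fun setT (Y k).
  apply: measurable_funM => //; apply: measurable_sum => j.
  apply: (mh k (h \o sgd_step f eta j)) => x.
  by apply: continuous_comp; [exact: cstep|exact: ch].
set r := mean_sq_error P theta_min theta.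
have rE k : r k = (\int[P]_w (h (theta k w))%:E)%E.
  by rewrite /r /mean_sq_error unlock.
have rS k : r k.+1 = (\int[P]_w (Y k w)%:E)%E.
  rewrite rE.
  exact: (integral_sgd_succ _ _ _ _ _ _ _ cstep hgamma htheta0 hindep hsgd).
have r_lty k : (r k < +oo)%E.
  elim: k => [//|k IH]; rewrite rS.
  have hY w :=
    mean_sqr_sgd_step_le f theta_min eta lambda (theta k w) hJ hsmooth.
  apply: (integral_lty_affine P (fun w => h (theta k w)) (Y k)
    _ _ _ _ _ _ hY) => //.
    exact: mh.
  by rewrite -rE.
have r_fin k : r k = (fine (r k))%:E.
  by rewrite fineK// ge0_fin_numE// rE integral_ge0// => w _; rewrite lee_fin.
have r_ge0 k : 0 <= fine (r k).
  by rewrite fine_ge0// rE integral_ge0// => w _; rewrite lee_fin.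
have -> : r = (fun k => (fine (r k))%:E) by apply/funext.
have D00 : 0 <= D0 by exact: rms_ge0.
have Lambda0 : 0 <= Lambda by exact: rms_ge0.
have b0 : 0 < 1 - 2 * eta * lambda0.
  move: heta; rewrite ltr_pdivlMr ?mulr_gt0//; lra.
have [D0E|D0N] := eqVneq D0 0.
  (* The floor is 0, so nonnegativity is the recursion with rate 0. *)
  have rec0 k : 0 * fine (r k) + (1 - 0) * z0 ^+ 2 <= fine (r k.+1).
    by rewrite /z0 error_floor0// expr0n/= mulr0 mul0r addr0.
  split; first exact: affine_recursion_limn_esup ltr01 rec0 r_ge0.
  by move=> _; exact: affine_recursion_limn_einf ltr01 rec0 (lexx _).
have z00 : 0 < z0 by apply: error_floor_gt0 => //; rewrite lt_def D0N.
pose a := error_rate eta lambda0 Lambda D0.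
have a1 : a < 1 by exact: error_rate_lt1.
have rec k : a * fine (r k) + (1 - a) * z0 ^+ 2 <= fine (r k.+1).
  rewrite rS rE.
  apply: (fine_integral_affine_le P (fun w => h (theta k w)) (Y k)) => //.
  - exact: mh.
  - move=> w; apply: le_trans (mean_sqr_sgd_step_ge f theta_min eta lambda0
      lambda (theta k w) hJ (ltW heta0) hdiff hmin hsmooth0 hsmooth).
    exact: error_rate_tangent.
  - by rewrite -rE.
  - by rewrite -rS.
split; first exact: affine_recursion_limn_esup a1 rec r_ge0.
move=> hz; apply: (affine_recursion_limn_einf _ _ _ a1 rec).
exact: error_rate_ge0.
Qed.
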